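(* Let $\{f_\theta\}_{\theta\in\Theta}$ be the one-parameter exponential family $f_\theta(y)=e^{\theta T(y)-b(\theta)}h(y)$ with respect to a $\sigma$-finite measure $\mu$, where $\Theta\subset\mathbb{R}$ is an interval and $b$ is differentiable everywhere on $\Theta$. Let $\theta_0\in\Theta$ and $\epsilon>0$, and for each threshold $A>0$ let $$\tau_G=\tau_G(A)=\inf\Big\{m\ge 1:\ \max_{1\le k\le m}\ \sup_{\theta\in\Theta:\,|\theta-\theta_0|\ge\epsilon}\ \sum_{i=k}^m\log\frac{f_\theta(Y_i)}{f_{\theta_0}(Y_i)}>A\Big\}.$$ Let $g$ be a probability density with respect to $\mu$, and suppose there exists $\theta_g\in\Theta$ with $|\theta_g-\theta_0|\ge\epsilon$ such that the (finite) integral $$\int\log\Big[\frac{f_{\theta_g}(y)}{f_{\theta_0}(y)}\Big]g(y)\,d\mu(y)$$ is strictly positive. Then $$\mathsf{E}_g[\tau_G]\ \le\ \frac{A}{\int\log\big[f_{\theta_g}(y)/f_{\theta_0}(y)\big]\,g(y)\,d\mu(y)}\,(1+o(1))\qquad\text{as }A\to\infty.$$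
   Context: $T$ and $h\ge 0$ are real-valued measurable functions, and each $f_\theta$, $\theta\in\Theta$, is a probability density with respect to $\mu$. The log-likelihood ratio is $\log\frac{f_\theta(y)}{f_{\theta_0}(y)}=(\theta-\theta_0)T(y)-b(\theta)+b(\theta_0)$. $Y_1,Y_2,\dots$ is an i.i.d. observation sequence; $\mathsf{E}_g$ denotes expectation under the probability measure for which all the $Y_i$ are i.i.d. with density $g$ with respect to $\mu$. The $o(1)$ term tends to $0$ as $A\to\infty$ with $g,\theta_g,\theta_0,\epsilon$ fixed. *)

(* Defs.v *)
From HB Require Import structures.
From mathcomp Require Import all_boot all_order all_algebra.
From mathcomp Require Import all_classical all_reals all_analysis.
From mathcomp Require Import ring.

Set Implicit Arguments.
Unset Strict Implicit.
Unset Printing Implicit Defensive.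

Import Order.TTheory GRing.Theory Num.Theory.
Import numFieldNormedType.Exports.

Local Open Scope classical_set_scope.
Local Open Scope ring_scope.

Definition is_density (d : measure_display) (X : measurableType d)
    (R : realType) (mu : {sigma_finite_measure set X -> \bar R})
    (f : X -> R) : Prop :=
  [/\ measurable_fun setT f,
      (forall y, 0 <= f y) &
      (\int[mu]_y (f y)%:E = 1)%E].

(* Differentiability relative to D, so one-sided at the endpoints of an
   interval that belong to it; the values of b outside D play no role. *)
Definition differentiable_on (R : realType) (D : set R) (b : R -> R) : Prop :=
  forall t, D t -> exists l : R,
    ((b s - b t) / (s - t)) @[s --> within D t^'] --> l.

Definition expfam (R : realType) (X : Type) (T h : X -> R) (b : R -> R)
    (theta : R) (y : X) : R :=
  expR (theta * T y - b theta) * h y.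

(* Where h vanishes, so do all densities of the family, and 0 / 0 is read as
   exp ((theta - theta0) T - b theta + b theta0), the value at all other points
   (see llrE), rather than as the library's 0. *)
Definition llr (R : realType) (X : Type) (T h : X -> R) (b : R -> R)
    (theta theta0 : R) (y : X) : R :=
  if h y == 0 then (theta - theta0) * T y - b theta + b theta0
  else ln (expfam T h b theta y / expfam T h b theta0 y).

Lemma llrE (R : realType) (X : Type) (T h : X -> R) (b : R -> R)
    (theta theta0 : R) (y : X) :
  llr T h b theta theta0 y = (theta - theta0) * T y - b theta + b theta0.
Proof.
rewrite /llr; case: eqVneq => // hy0.
rewrite /expfam -mulf_div divff // mulr1 -expRN -expRD expRK.
by ring.
Qed.

Definition mutually_independent (d d' : measure_display)
    (W : measurableType d') (X : measurableType d) (R : realType)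
    (P : probability W R) (Y : nat -> {RV P >-> X}) : Prop :=
  forall (s : seq nat) (B : nat -> set X),
    uniq s -> (forall i, measurable (B i)) ->
    (P (\big[setI/setT]_(i <- s) (Y i @^-1` B i)) =
     \prod_(i <- s) P (Y i @^-1` B i))%E.

Definition iid_density (d d' : measure_display)
    (W : measurableType d') (X : measurableType d) (R : realType)
    (P : probability W R) (mu : {sigma_finite_measure set X -> \bar R})
    (g : X -> R) (Y : nat -> {RV P >-> X}) : Prop :=
  mutually_independent Y /\
  forall (i : nat) (B : set X), measurable B ->
    distribution P (Y i) B = (\int[mu]_(y in B) (g y)%:E)%E.

(* max_(k < m) sup_theta sum_(k <= i < m): y i stands for the (i+1)-st
   observation, so this is the statistic after m observations. *)
Definition glr_stat (R : realType) (X : Type) (T h : X -> R) (b : R -> R)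
    (Theta : set R) (theta0 eps : R) (y : nat -> X) (m : nat) : \bar R :=
  \big[maxe/-oo%E]_(0 <= k < m)
    ereal_sup [set (\sum_(k <= i < m) llr T h b theta theta0 (y i))%:E
              | theta in [set t | Theta t /\ eps <= `|t - theta0|]].

Definition tauG (R : realType) (X : Type) (T h : X -> R) (b : R -> R)
    (Theta : set R) (theta0 eps A : R) (y : nat -> X) : \bar R :=
  ereal_inf [set m%:R%:E | m in
    [set m : nat | (1 <= m)%N /\
                   (A%:E < glr_stat T h b Theta theta0 eps y m)%E]].

(* Main.v *)
Require Import Defs.
From HB Require Import structures.
From mathcomp Require Import all_boot all_order all_algebra.
From mathcomp Require Import all_classical all_reals all_analysis.
From mathcomp Require Import measurable_realfun lra.

Set Implicit Arguments.
Unset Strict Implicit.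
Unset Printing Implicit Defensive.

Import Order.TTheory GRing.Theory Num.Theory.
Import numFieldNormedType.Exports.

Local Open Scope classical_set_scope.
Local Open Scope ring_scope.

(* Let x_i be the log-likelihood ratio of Y_i at theta_g, truncated from above
   at c. The generalised likelihood ratio rule stops no later than the first
   passage of the random walk of the x_i above A, and the walk stopped there is
   at most A + c. Since survival up to time i is independent of Y_i, Wald's
   identity gives E[x_0] * sum_i P(alive at i) <= A + c, so
   E[tau_G] <= (A + c) / E[x_0]. By dominated convergence E[x_0] tends, as c
   grows, to the integral in the theorem. *)

(** * Integral comparison, and integration against a measure with a density *)

(* Unlike [ge0_le_integral], no measurability is assumed: [tauG] involves an
   uncountable supremum. *)
Lemma ge0_le_integral_nomeas d (T : measurableType d) (R : realType)
    (mu : {measure set T -> \bar R}) (f1 f2 : T -> \bar R) :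
  (forall x, 0 <= f1 x)%E -> (forall x, f1 x <= f2 x)%E ->
  (\int[mu]_x f1 x <= \int[mu]_x f2 x)%E.
Proof.
move=> f10 f12; have f20 x : (0 <= f2 x)%E := le_trans (f10 x) (f12 x).
rewrite !ge0_integralTE //.
apply: ereal_sup_le => _ /= [h hf <-]; exists h => // x.
exact: le_trans (hf x) (f12 x).
Qed.

(** The function [g] and the Radon-Nikodym derivative of [nu] have the same integral over every
    measurable set, so they agree [mu]-almost everywhere. *)
Lemma ge0_integral_density d (X : measurableType d) (R : realType)
    (mu : {sigma_finite_measure set X -> \bar R})
    (nu : {finite_measure set X -> \bar R}) (g : X -> R) (f : X -> \bar R) :
  measurable_fun [set: X] g ->
  (forall B, measurable B -> nu B = \int[mu]_(y in B) (g y)%:E)%E ->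
  measurable_fun [set: X] f -> (forall y, 0 <= f y)%E ->
  (\int[nu]_y f y = \int[mu]_y (f y * (g y)%:E))%E.
Proof.
move=> mg nug mf f0.
have numu : nu `<< mu.
  apply/null_content_dominatesP => B mB muB0.
  rewrite nug//; apply: null_set_integral => //.
  by apply/measurable_EFinP; exact: measurable_funTS.
rewrite -(Radon_Nikodym_SigmaFinite.change_of_variables numu)//.
have mRN : measurable_fun setT (Radon_Nikodym_SigmaFinite.f nu mu).
  exact: measurable_int (Radon_Nikodym_SigmaFinite.f_integrable _).
apply: ae_eq_integral => //.
- exact: emeasurable_funM.
- by apply: emeasurable_funM => //; exact/measurable_EFinP.
apply: ae_eqe_mul2l; apply: integral_ae_eq => //.
- exact: Radon_Nikodym_SigmaFinite.f_integrable.
- exact/measurable_EFinP.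
- by move=> E _ mE; rewrite -Radon_Nikodym_SigmaFinite.f_integral// nug.
Qed.

Section integral_density.
Context d (X : measurableType d) (R : realType).
Variables (mu : {sigma_finite_measure set X -> \bar R})
  (nu : {finite_measure set X -> \bar R}) (g l : X -> R).
Hypotheses (mg : measurable_fun setT g) (g0 : forall y, 0 <= g y).
Hypothesis nug :
  forall B, measurable B -> (nu B = \int[mu]_(y in B) (g y)%:E)%E.
Hypotheses (ml : measurable_fun setT l)
  (intlg : mu.-integrable setT (fun y => (l y * g y)%:E)).

Lemma integrable_density : nu.-integrable setT (EFin \o l).
Proof.
apply/integrableP; split; first exact/measurable_EFinP.
rewrite (ge0_integral_density mg nug)//; last first.
  by apply: measurableT_comp => //; exact/measurable_EFinP.
have /integrableP[_] := intlg; congr (_ < _)%E.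
by apply: eq_integral => y _ /=; rewrite normrM (ger0_norm (g0 y)).
Qed.

(** Since [g] is nonnegative, the positive and negative parts of [l * g] are those of [l] times
    [g]. *)
Lemma integral_density :
  (\int[nu]_y (l y)%:E = \int[mu]_y (l y * g y)%:E)%E.
Proof.
have ml' : measurable_fun setT (EFin \o l) by exact/measurable_EFinP.
rewrite integralE [RHS]integralE; congr (_ - _)%E;
  rewrite (ge0_integral_density mg nug)//.
- apply: eq_integral => y _; rewrite !funeposE.
  by rewrite EFinM muleC maxe_pMr// ?mule0 1?muleC// lee_fin.
- exact: measurable_funepos.
- apply: eq_integral => y _; rewrite !funenegE.
  by rewrite EFinM muleC -mulNe maxe_pMr// ?mule0 1?muleC// lee_fin.
- exact: measurable_funeneg.
Qed.

End integral_density.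

(** * Independence of the past and the next observation *)

Section independent_event.
Context d d' (W : measurableType d') (X : measurableType d) (R : realType).
Variables (P : probability W R) (Z : {RV P >-> X}) (E : set W).
Hypothesis mE : measurable E.
Hypothesis indep : forall B, measurable B ->
  (P (E `&` Z @^-1` B) = P E * P (Z @^-1` B))%E.

(** Both sides integrate [f], one against [B |-> P (E & Z in B)], the other against [P E] times the
    law of [Z]; by [indep] these measures coincide. *)
Lemma ge0_integral_indep (f : X -> \bar R) :
  measurable_fun setT f -> (forall y, 0 <= f y)%E ->
  (\int[P]_(w in E) f (Z w) = P E * \int[P]_w f (Z w))%E.
Proof.
move=> mf f0.
have PE : P E = (NngNum (fine_ge0 (measure_ge0 P E)))%:num%:E.
  by rewrite /= fineK// fin_num_measure.
have mfZ : measurable_fun setT (f \o Z) by exact: measurableT_comp.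
transitivity (\int[mrestr P mE]_w f (Z w))%E.
  rewrite [RHS](ge0_negligible_integral (measurableC mE))//; last first.
    by rewrite /= /mrestr setICl measure0.
  rewrite setTD setCK; apply: eq_measure_integral => A mA AE /=.
  by rewrite /mrestr setIidl.
transitivity (\int[pushforward (mrestr P mE) Z]_y f y)%E.
  by rewrite ge0_integral_pushforward.
rewrite -ge0_integral_distribution// [in RHS]PE -ge0_integral_mscale//.
apply: eq_measure_integral => B mB _.
by rewrite /= /mscale /pushforward /mrestr /= -PE setIC indep.
Qed.

Lemma integral_indep (f : X -> R) :
  measurable_fun setT f -> P.-integrable setT (EFin \o (f \o Z)) ->
  (\int[P]_(w in E) (f (Z w))%:E = P E * \int[P]_w (f (Z w))%:E)%E.
Proof.
move=> mf intf; have mf' : measurable_fun setT (EFin \o f).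
  exact/measurable_EFinP.
rewrite integralE [in RHS]integralE.
have -> : (fun w => (f (Z w))%:E)^\+%E = (fun w => (EFin \o f)^\+%E (Z w)).
  by apply/funext => w; rewrite !funeposE.
have -> : (fun w => (f (Z w))%:E)^\-%E = (fun w => (EFin \o f)^\-%E (Z w)).
  by apply/funext => w; rewrite !funenegE.
rewrite !(ge0_integral_indep (f := (EFin \o f)^\+%E))//; last first.
  exact: measurable_funepos.
rewrite !(ge0_integral_indep (f := (EFin \o f)^\-%E))//; last first.
  exact: measurable_funeneg.
rewrite [RHS]muleBr//; first by rewrite fin_num_measure.
(* A finite integral of the positive part excludes the form [oo - oo]. *)
apply: fin_num_adde_defr.
have := integrable_pos_fin_num measurableT intf.
by congr (_ \is a _); apply: eq_integral => w _; rewrite !funeposE.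
Qed.

End independent_event.

(** A pi-system generating the sigma-algebra of the first [n] observations; the product formula of
    [mutually_independent] applies to its members directly. *)
Definition past_cylinders (W : Type) d (X : measurableType d)
    (Y : nat -> W -> X) (n : nat) : set (set W) :=
  [set E | exists2 B : nat -> set X, forall i, measurable (B i) &
     E = \big[setI/setT]_(i <- iota 0 n) (Y i @^-1` B i)].

Lemma past_cylinders_setI (W : Type) d (X : measurableType d)
    (Y : nat -> W -> X) (n : nat) : setI_closed (past_cylinders Y n).
Proof.
move=> _ _ [B mB ->] [C mC ->]; exists (fun i => B i `&` C i).
  by move=> i; exact: measurableI.
by rewrite -big_split.
Qed.

Lemma past_cylinders_coord (W : Type) d (X : measurableType d)
    (Y : nat -> W -> X) (n i : nat) (B : set X) :
  (i < n)%N -> measurable B -> past_cylinders Y n (Y i @^-1` B).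
Proof.
move=> ltin mB; exists (fun j => if j == i then B else setT).
  by move=> j; case: ifP.
rewrite (bigD1_seq i) ?iota_uniq ?mem_iota//= eqxx.
by rewrite big1 ?setIT// => j /negPf ->; rewrite preimage_setT.
Qed.

Section independent_sequence.
Context d d' (W : measurableType d') (X : measurableType d) (R : realType).
Variables (P : probability W R) (Y : nat -> {RV P >-> X}).
Hypothesis indepY : mutually_independent Y.

Lemma past_cylinders_measurable n :
  past_cylinders (fun i => Y i : W -> X) n `<=` measurable.
Proof.
move=> _ [B mB ->]; apply: big_ind => [|E F|i _].
- exact: measurableT.
- exact: measurableI.
- by rewrite -[_ @^-1` _]setTI; exact: measurable_funP.
Qed.

(** Both sides are finite measures in [E]; they agree on the pi-system of cylinders, hence on the
    sigma-algebra it generates. *)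
Lemma indep_past n (E : set W) (B : set X) :
  <<s past_cylinders (fun i => Y i : W -> X) n >> E -> measurable B ->
  (P (E `&` Y n @^-1` B) = P E * P (Y n @^-1` B))%E.
Proof.
move=> pE mB.
have mYB : measurable (Y n @^-1` B).
  by rewrite -[_ @^-1` _]setTI; exact: measurable_funP.
have PYB : P (Y n @^-1` B) =
    (NngNum (fine_ge0 (measure_ge0 P (Y n @^-1` B))))%:num%:E.
  by rewrite /= fineK// fin_num_measure.
rewrite muleC PYB.
apply: (@g_sigma_algebra_measure_unique _ R W _ (@past_cylinders_measurable n)
  (fun=> setT) _ _ (mrestr P mYB)
  (mscale (NngNum (fine_ge0 (measure_ge0 P (Y n @^-1` B)))) P)) => //.
- move=> _; exists (fun=> setT) => //.
  by rewrite big1// => i _; rewrite preimage_setT.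
- by rewrite bigcup_const.
- exact: past_cylinders_setI.
- move=> _ [C mC ->]; rewrite /= /mrestr /mscale -PYB.
  (* With [B] appended as side [n], the product formula is used once on the indices up to [n] and
     once on those below [n]. *)
  pose C' i := if i == n then B else C i.
  have mC' i : measurable (C' i) by rewrite /C'; case: ifP.
  have CC' : {in iota 0 n, forall i, C' i = C i}.
    by move=> i; rewrite mem_iota/= add0n /C' => /ltn_eqF ->.
  have -> : \big[setI/setT]_(i <- iota 0 n) (Y i @^-1` C i) =
            \big[setI/setT]_(i <- iota 0 n) (Y i @^-1` C' i).
    by apply: eq_big_seq => i /CC' ->.
  have -> : Y n @^-1` B = Y n @^-1` C' n by rewrite /C' eqxx.
  have := indepY (iota_uniq 0 n.+1) mC'.
  rewrite -addn1 iotaD !big_cat/= !big_seq1 add0n => ->.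
  by rewrite indepY// ?iota_uniq// muleC.
- move=> _; rewrite /= /mrestr setTI.
  by rewrite (le_lt_trans (probability_le1 _ _))// ltry.
Qed.

End independent_sequence.

(** * The stopped random walk *)

(** Here [n] counts the increments already taken: only [x i] with [i < n] enter, so the increment
    [x n] still lies in the future. *)
Definition alive (R : realType) (A : R) (x : nat -> R) (n : nat) : Prop :=
  forall j, (j <= n)%N -> \sum_(0 <= i < j) x i <= A.

Lemma aliveW (R : realType) (A : R) (x : nat -> R) m n :
  (m <= n)%N -> alive A x n -> alive A x m.
Proof. by move=> mn h j jm; apply: h; exact: leq_trans mn. Qed.

(* The left-hand side is the walk stopped at its first passage above [A], an
   epoch at which it exceeds [A] by at most one increment. *)
Lemma stopped_walk_le (R : realType) (A c : R) (x : nat -> R) (n : nat) :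
  0 <= A -> 0 <= c -> (forall i, x i <= c) ->
  \sum_(0 <= i < n) x i * (`[< alive A x i >])%:R <= A + c.
Proof.
move=> A0 c0 xc; pose D n := \sum_(0 <= i < n) x i * (`[< alive A x i >])%:R.
(* As long as the walk is alive, [D n] is the plain partial sum, hence at most [A], and one more
   increment adds at most [c]; afterwards [D] is frozen. *)
suff : (alive A x n -> D n = \sum_(0 <= i < n) x i) /\ D n <= A + c by case.
elim: n => [|n [IH1 IH2]]; first by rewrite /D !big_geq// addr_ge0.
have -> : D n.+1 = D n + x n * (`[< alive A x n >])%:R.
  by rewrite /D big_nat_recr.
split => [an1|].
  have an : alive A x n by exact: aliveW an1.
  by rewrite IH1// asboolT// mulr1 big_nat_recr.
case: asboolP => [an|_]; last by rewrite mulr0 addr0.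
by rewrite mulr1 lerD// IH1//; exact: an.
Qed.

(** The event is an intersection of half-line conditions on partial sums, each measurable for the
    sigma-algebra of the past, which is put on [W] as the structure [T]. *)
Lemma alive_past_pointed (W : pointedType) d (X : measurableType d)
    (R : realType) (Y : nat -> W -> X) (f : X -> R) (A : R) (n : nat) :
  measurable_fun [set: X] f ->
  <<s past_cylinders Y n >> [set w | alive A (fun i => f (Y i w)) n].
Proof.
move=> mf; set G := past_cylinders Y n; pose T := g_sigma_algebraType G.
have mY i : (i < n)%N -> measurable_fun setT (Y i : T -> X).
  move=> ltin _ B mB; rewrite setTI; apply: sub_sigma_algebra.
  exact: past_cylinders_coord.
have mS j : (j <= n)%N ->
    measurable_fun setT ((fun w => \sum_(0 <= i < j) f (Y i w)) : T -> R).
  elim: j => [_|j IH ltjn].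
    by under eq_fun do rewrite big_geq//; exact: measurable_cst.
  under eq_fun do rewrite big_nat_recr//=.
  apply: measurable_funD; first exact: (IH (ltnW ltjn)).
  by apply: measurableT_comp => //; exact: mY.
rewrite (_ : [set w | _] = \bigcap_(j in [set j | (j <= n)%N])
    (fun w => \sum_(0 <= i < j) f (Y i w)) @^-1` `]-oo, A]); last first.
  by apply/seteqP; split => [w h j /= jn|w h j /= jn];
    [rewrite in_itv/= h|have := h _ jn; rewrite /= in_itv].
apply: (@bigcap_measurable _ T); first by exists 0.
move=> j /= jn; rewrite -[X in measurable X]setTI.
exact: mS.
Qed.

(** * Expected first-passage time *)

Section first_passage.
Context d d' (W : measurableType d') (X : measurableType d) (R : realType).
Variables (P : probability W R) (Y : nat -> {RV P >-> X}).
Hypothesis indepY : mutually_independent Y.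
Variables (f : X -> R) (A : R).
Hypothesis mf : measurable_fun [set: X] f.

Let E n := [set w | alive A (fun i => f (Y i w)) n].

Lemma alive_past n : <<s past_cylinders (fun i => Y i : W -> X) n >> (E n).
Proof.
(* A space of total mass 1 is nonempty, which provides the base point. *)
have /set0P[w0 _] : [set: W] != set0.
  apply/eqP => W0; have := probability_setT P.
  by rewrite W0 measure0 => /eqP; rewrite eq_sym onee_eq0.
pose Wp : pointedType := HB.pack_for pointedType W (isPointed.Build W w0).
exact: (@alive_past_pointed Wp).
Qed.

Lemma alive_measurable n : measurable (E n).
Proof.
have := @alive_past n; apply: smallest_sub.
  exact: sigma_algebra_measurable.
exact: past_cylinders_measurable.
Qed.

Variables (c m : R).
Hypotheses (A0 : 0 <= A) (c0 : 0 <= c) (m0 : 0 < m).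
Hypothesis f_le_c : forall y, f y <= c.
Hypothesis intf : forall n, P.-integrable setT (EFin \o (f \o Y n)).
Hypothesis meanf : forall n, (\int[P]_w (f (Y n w))%:E = m%:E)%E.

(* Wald's identity for the stopped walk: [alive] at time [i] depends on the
   first [i] observations only, hence is independent of the [i]-th increment. *)
Lemma sum_alive_le n :
  (\sum_(0 <= i < n) P (E i) <= ((A + c) / m)%:E)%E.
Proof.
have intE i : P.-integrable setT
    (fun w => (f (Y i w) * (`[< E i w >])%:R)%:E).
  apply: le_integrable (intf i) => //.
    apply/measurable_EFinP; apply: measurable_funM.
      exact: measurableT_comp.
    rewrite (_ : (fun _ => _) = \1_(E i)); last by apply/funext => w.
    exact/measurable_indic/alive_measurable.
  move=> w _ /=; rewrite lee_fin normrM ler_piMr//.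
  by case: asboolP; rewrite ?normr1 ?normr0.
have Wald i : (\int[P]_w (f (Y i w) * (`[< E i w >])%:R)%:E = P (E i) * m%:E)%E.
  rewrite -(meanf i) -(integral_indep (alive_measurable i))//; last first.
    by move=> B mB; apply: indep_past => //; exact: alive_past.
  rewrite [RHS]integral_mkcond; apply: eq_integral => w _.
  rewrite patchE; case: asboolP => Ew.
    by rewrite mulr1 mem_set.
  by rewrite mulr0 memNset.
rewrite EFinM lee_pdivlMr//.
rewrite ge0_sume_distrl//.
under eq_bigr do rewrite -Wald.
rewrite -integral_sum//.
apply: (@le_trans _ _ (\int[P]_w (A + c)%:E)%E).
  apply: le_integral => //.
  - by apply: integrable_sum.
  - exact: finite_measure_integrable_cst.
  - by move=> w _; rewrite sumEFin lee_fin; exact: stopped_walk_le.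
by rewrite integral_cst// [X in (_ * X)%E]probability_setT mule1.
Qed.

(** The sum of the indicators counts the times at which the walk is alive, so it is the
    first-passage time. Sum and integral are exchanged, and [sum_alive_le] bounds the partial sums
    uniformly. *)
Lemma integral_alive_le :
  (\int[P]_w (\sum_(0 <= i <oo) (\1_(E i) w)%:E) <= ((A + c) / m)%:E)%E.
Proof.
rewrite integral_nneseries//; last first.
  by move=> n; apply/measurable_EFinP/measurable_indic; exact: alive_measurable.
apply: lime_le; first by apply: is_cvg_nneseries => n _ _; apply: integral_ge0.
apply: nearW => n; apply: le_trans (sum_alive_le n).
by apply: lee_sum => i _; rewrite integral_indic// ?setIT//;
  exact: alive_measurable.
Qed.

End first_passage.

(** * Comparison of the stopping rule with the first passage *)

Lemma tauG_ge0 (R : realType) (X : Type) (T h : X -> R) (b : R -> R)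
    (Theta : set R) (theta0 eps A : R) (y : nat -> X) :
  (0 <= tauG T h b Theta theta0 eps A y)%E.
Proof. by apply/ereal_infP => _ [m _ <-]; rewrite lee_fin. Qed.

(** If the walk never exceeds [A], the series is infinite. Otherwise let [m] be its first passage:
    the series is at least [m], and the rule has stopped by [m]. *)
Lemma tauG_le_alive (R : realType) (X : Type) (T h : X -> R) (b : R -> R)
    (Theta : set R) (theta0 eps A thetag : R) (y : nat -> X) (x : nat -> R) :
  Theta thetag -> eps <= `|thetag - theta0| -> 0 <= A ->
  (forall i, x i <= llr T h b thetag theta0 (y i)) ->
  (tauG T h b Theta theta0 eps A y <=
   \sum_(0 <= i <oo) (`[< alive A x i >]%:R : R)%:E)%E.
Proof.
move=> Tg sep A0 xl.
have ge0 i : (0 <= (`[< alive A x i >]%:R : R)%:E)%E by rewrite lee_fin.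
have partial_le m : (forall i, (i < m)%N -> alive A x i) ->
    (m%:R%:E <= \sum_(0 <= i <oo) (`[< alive A x i >]%:R : R)%:E)%E.
  move=> am; apply: le_trans (nneseries_lim_ge m _) => //.
  rewrite sumEFin lee_fin.
  rewrite (eq_big_nat _ _ (F2 := fun=> 1)); last first.
    by move=> i /andP[_ im]; rewrite asboolT//; exact: am.
  by rewrite big_const_nat subn0 iter_addr addr0.
have [exM|aliveA] := pselect (exists m, ~~ `[< alive A x m >]); last first.
  have aA m : alive A x m.
    by apply: contrapT => /asboolPn nam; apply: aliveA; exists m.
  rewrite [leRHS](_ : _ = +oo%E) ?leey//.
  apply/eqyP => r r0.
  apply: le_trans (partial_le (Num.truncn r).+1 _) => //.
  by rewrite lee_fin; apply/ltW/truncnS_gt.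
case: (ex_minnP exM) => m /asboolPn nam minm.
have am i : (i < m)%N -> alive A x i.
  by move=> im; apply: contrapT => /asboolPn /minm; rewrite leqNgt im.
(* The empty sum does not exceed [A], as [0 <= A]; the rule only admits times from 1 on. *)
have m_gt0 : (0 < m)%N.
  rewrite lt0n; apply/eqP => m0; apply: nam => j; rewrite m0 leqn0 => /eqP ->.
  by rewrite big_geq.
apply: le_trans (partial_le m am); apply: ereal_inf_lbound; exists m => //.
split=> //.
(* By minimality of [m] all shorter sums are at most [A], so the sum of [m] increments is the one
   that exceeds it. *)
apply: (@lt_le_trans _ _ (\sum_(0 <= i < m) x i)%:E).
  rewrite lte_fin ltNge; apply: contra_notN nam => Sm j.
  by rewrite leq_eqVlt => /orP[/eqP->//|jm]; exact: (am _ jm).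
apply: (@le_trans _ _ (\sum_(0 <= i < m) llr T h b thetag theta0 (y i))%:E).
  by rewrite lee_fin; apply: ler_sum.
(* The statistic is bounded below by its term with starting index 0 and parameter [thetag]. *)
apply: (@bigmax_sup_seq _ _ _ _ -oo%E 0%N) => //.
  by rewrite mem_index_iota.
by apply: ereal_sup_ubound; exists thetag.
Qed.

(** * Removing the truncation, and the limit as [A] grows *)

Lemma integrable_distribution d d' (W : measurableType d')
    (X : measurableType d) (R : realType) (P : probability W R)
    (Z : {RV P >-> X}) (f : X -> R) :
  (distribution P Z).-integrable setT (EFin \o f) ->
  P.-integrable setT (EFin \o (f \o Z)).
Proof.
move=> /integrableP[mf fZ]; apply/integrableP; split.
  by apply: (@measurableT_comp _ _ _ _ _ _ (EFin \o f)).
move: fZ; rewrite ge0_integral_distribution//.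
exact: measurableT_comp.
Qed.

(** At each point the truncated values are eventually constant, and since the levels are nonnegative
    they are dominated by the absolute value of [l]. *)
Lemma integral_truncation_cvg d (X : measurableType d) (R : realType)
    (Q : {finite_measure set X -> \bar R}) (l : X -> R) :
  Q.-integrable setT (EFin \o l) ->
  (\int[Q]_y (Num.min (l y) n%:R)%:E)%E @[n --> \oo] -->
  (\int[Q]_y (l y)%:E)%E.
Proof.
move=> intl.
have ml : measurable_fun setT l.
  by have /integrableP[/measurable_EFinP] := intl.
have [|||||_ _] := @dominated_convergence _ X R Q setT measurableT
  (fun n y => (Num.min (l y) n%:R)%:E) (EFin \o l) (abse \o (EFin \o l)).
- by move=> n; apply/measurable_EFinP; exact: measurable_minr.
- exact/measurable_EFinP.
- apply: aeW => y _; apply: cvg_near_cst.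
  near=> n; congr EFin; apply/min_idPl.
  near: n; exact: nbhs_infty_ger.
- exact: integrable_abse.
- apply: aeW => y n _ /=; rewrite lee_fin.
  have [//|nl] := leP (l y) n%:R.
  by rewrite ger0_norm// (le_trans (ltW nl))// ler_norm.
exact.
Unshelve. all: by end_near. Qed.

(** For fixed [n] the overshoot [n] is negligible against [A]. So [n] is chosen first, to bring
    [m n] close to [I], and only then does [A] tend to infinity. *)
Lemma asymptotic_upper_bound (R : realType) (I : R) (m : nat -> R)
    (t : R -> \bar R) :
  0 < I -> m n @[n --> \oo] --> I -> (forall A, 0 <= t A)%E ->
  (forall (A : R) n, 0 < A -> 0 < m n -> (t A <= ((A + n%:R) / m n)%:E)%E) ->
  exists r : R -> R, r A @[A --> +oo] --> 0 /\
    forall A, 0 < A -> (t A <= (A / I * (1 + r A))%:E)%E.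
Proof.
move=> I0 mI t0 tle.
have m_gt (x : R) : x < I -> exists n, x < m n.
  move=> xI; have [n _ /(_ n (leqnn n))] := cvgr_gt I mI x xI.
  by exists n.
have t_fin A : 0 < A -> t A \is a fin_num.
  move=> A0; have [n m0] := m_gt 0 I0.
  by rewrite ge0_fin_numE// (le_lt_trans (tle _ _ A0 m0))// ltry.
(* The positive part of the relative excess of [t A] over [A / I]: its convergence to 0 needs upper
   bounds on [t] only. *)
exists (fun A => Num.max 0 (fine (t A) * I / A - 1)); split; last first.
  move=> A A0; rewrite -(fineK (t_fin A A0)) lee_fin.
  have AI0 : 0 < A / I by exact: divr_gt0.
  rewrite -ler_pdivrMl// invf_div -lerBlDl le_max; apply/orP; right.
  by rewrite mulrC mulrA.
apply/cvgrPdist_le => e e0.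
have e2 : 0 < 1 + e / 2 by rewrite addr_gt0// divr_gt0.
(* This gives [I / m n < 1 + e / 2]; the other [e / 2] absorbs [n] through [An], for a total factor
   [1 + e]. *)
have [|n mn] := m_gt (I / (1 + e / 2)).
  by rewrite ltr_pdivrMr// ltr_pMr// ltrDl divr_gt0.
have m0 : 0 < m n by apply: lt_trans mn; exact: divr_gt0.
near=> A.
have A0 : 0 < A by near: A; exact: nbhs_pinfty_gt.
rewrite sub0r normrN ger0_norm ?le_max ?lexx// ge_max ltW//=.
have tA : fine (t A) <= (A + n%:R) / m n.
  by rewrite -lee_fin fineK ?t_fin// tle.
have An : n%:R * (1 + e / 2) <= A * (e / 2).
  rewrite -ler_pdivrMr; last exact: divr_gt0.
  by near: A; apply: nbhs_pinfty_ge; exact: num_real.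
rewrite lerBlDr ler_pdivrMr//.
apply: (@le_trans _ _ ((A + n%:R) / m n * I)); first by rewrite ler_pM2r.
apply: (@le_trans _ _ ((A + n%:R) * (1 + e / 2))).
  rewrite -mulrA ler_wpM2l ?addr_ge0 ?ler0n ?ltW//.
  by rewrite mulrC ltr_pdivrMr// mulrC -ltr_pdivrMr.
rewrite mulrDl; apply: le_trans (lerD (lexx _) An) _.
by rewrite -mulrDr mulrC ler_pM2r//; lra.
Unshelve. all: by end_near. Qed.


Theorem theorem4p3 (R : realType) (d : measure_display) (X : measurableType d)
    (mu : {sigma_finite_measure set X -> \bar R})
    (T h : X -> R) (b : R -> R) (Theta : set R)
    (hT : measurable_fun setT T) (hh : measurable_fun setT h)
    (h_ge0 : forall y, 0 <= h y)
    (hTheta : is_interval Theta) (hb : differentiable_on Theta b)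
    (hf : forall theta, Theta theta -> is_density mu (expfam T h b theta))
    (theta0 eps : R) (htheta0 : Theta theta0) (heps : 0 < eps)
    (g : X -> R) (hg : is_density mu g)
    (d' : measure_display) (W : measurableType d') (P : probability W R)
    (Y : nat -> {RV P >-> X}) (hY : iid_density mu g Y)
    (thetag : R) (hthetag : Theta thetag) (hsep : eps <= `|thetag - theta0|)
    (hint : mu.-integrable setT
              (fun y => (llr T h b thetag theta0 y * g y)%:E))
    (hpos : 0 < \int[mu]_y (llr T h b thetag theta0 y * g y)) :
  exists r : R -> R,
    r A @[A --> +oo] --> 0 /\
    forall A : R, 0 < A ->
      (\int[P]_w tauG T h b Theta theta0 eps A (fun i => Y i w) <=
       (A / (\int[mu]_y (llr T h b thetag theta0 y * g y))%R
          * (1 + r A))%:E)%E.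
Proof.
have ml : measurable_fun setT (llr T h b thetag theta0).
  rewrite (_ : llr _ _ _ _ _ =
    (fun y => (thetag - theta0) * T y - b thetag + b theta0)); last first.
    by apply/funext => y; rewrite llrE.
  by do 2 (apply: measurable_funD => //); exact: measurable_funM.
have [indepY densY] := hY; have [mg g_ge0 _] := hg.
set l := llr T h b thetag theta0 in ml hint hpos *.
set I : R := (\int[mu]_y (l y * g y))%R in hpos *.
have intl i : (distribution P (Y i)).-integrable setT (EFin \o l).
  exact: (integrable_density mg g_ge0 (densY i)).
have meanl : (\int[distribution P (Y 0%N)]_y (l y)%:E = I%:E)%E.
  rewrite (integral_density mg g_ge0 (densY 0%N))// /I /Rintegral fineK//.
  exact: integrable_fin_num.
pose x n y : R := Num.min (l y) n%:R.
have mx n : measurable_fun setT (x n) by exact: measurable_minr.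
have intx n i : (distribution P (Y i)).-integrable setT (EFin \o x n).
  apply: le_integrable (intl i) => //; first exact/measurable_EFinP.
  move=> y _ /=; rewrite lee_fin /x.
  have [//|nl] := leP (l y) n%:R.
  by rewrite ger0_norm// (le_trans (ltW nl))// ler_norm.
(* This mean may fail to be positive for small [n]; the bound below is required only where
   [0 < m n]. *)
pose m n := fine (\int[distribution P (Y 0%N)]_y (x n y)%:E)%E.
have meanx n i : (\int[P]_w (x n (Y i w))%:E = (m n)%:E)%E.
  rewrite /m fineK; last exact: (integrable_fin_num measurableT (intx n 0%N)).
  transitivity (\int[distribution P (Y i)]_y (x n y)%:E)%E.
    rewrite integral_distribution//; first exact/measurable_EFinP.
    exact: (integrable_distribution (intx n i)).
  (* All observations have the law given by [g], so the mean computed at index 0 serves every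
     index. *)
  by apply: eq_measure_integral => B mB _; rewrite /= !densY.
apply: (@asymptotic_upper_bound _ I m) => //.
- apply: fine_cvg; rewrite -meanl.
  exact: (integral_truncation_cvg (Q := distribution P (Y 0%N)) (intl 0%N)).
- by move=> A; apply: integral_ge0 => w _; exact: tauG_ge0.
- move=> A n A0 m0.
  (* The truncation level [n] is the bound [c] on the increments. *)
  apply: le_trans (integral_alive_le indepY (mx n) (ltW A0) (ler0n _ n) m0 _
    (fun i => integrable_distribution (intx n i)) (meanx n)); last first.
    by move=> y; rewrite ge_min lexx orbT.
  apply: ge0_le_integral_nomeas => w; first exact: tauG_ge0.
  apply: (tauG_le_alive (x := fun i => x n (Y i w)) hthetag hsep (ltW A0)).
  by move=> i; rewrite ge_min lexx.
Qed.
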